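(* Let $K \geq 1$, and let $A,B \subseteq \mathbb{F}_2^n$ be non-empty sets such that $|A+B| \leq K |A|^{1/2} |B|^{1/2}$. Then there exists a linear subspace $H \subseteq \mathbb{F}_2^n$ with $|H| \gg K^{-O(\sqrt{K})}|A|$ and elements $x,y \in \mathbb{F}_2^n$ such that \[ |A \cap (x + H)|^{1/2} |B \cap (y + H)|^{1/2} \geq \frac{1}{2K}|H|.\]
   Context: $\mathbb{F}_2^n$ is the $n$-dimensional vector space over the two-element field. $A+B=\{a+b: a\in A, b\in B\}$. The notation $|H| \gg K^{-O(\sqrt{K})}|A|$ means $|H| \geq c K^{-C\sqrt{K}}|A|$ for some absolute constants $c, C>0$ (independent of $n$, $K$, $A$, $B$). *)

(* Defs.v *)
From HB Require Import structures.
From mathcomp Require Import all_boot all_order all_algebra.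

Set Implicit Arguments.
Unset Strict Implicit.
Unset Printing Implicit Defensive.

Import GRing.Theory.
Local Open Scope ring_scope.

Definition sumset (V : finZmodType) (A B : {set V}) : {set V} :=
  [set a + b | a in A, b in B].

Definition translate (V : finZmodType) (x : V) (H : {set V}) : {set V} :=
  [set x + h | h in H].

Definition vspace_set (n : nat) (H : {vspace 'rV['F_2]_n}) :
  {set 'rV['F_2]_n} := [set h | h \in H].

(* Main.v *)
Require Import Defs.
From HB Require Import structures.
From mathcomp Require Import all_boot all_order all_algebra.
From mathcomp Require Import reals exp.
From mathcomp Require Import ring lra.

Set Implicit Arguments.
Unset Strict Implicit.
Unset Printing Implicit Defensive.

Import Order.TTheory GRing.Theory Num.Theory.
Local Open Scope ring_scope.

(** Fix [th] of order [1 / sqrt K] and follow the quantity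
    [phi A B = |A+B| / (|A||B|)^(1/2 + th)] while restricting [A] and [B] to
    cosets of smaller and smaller subspaces.  If [A] and [B], lying in cosets
    of [H], have geometric mean size below [|H| / 2K], then Cauchy-Schwarz and
    Parseval produce a character, nontrivial on [H], at which the product of
    the normalised Fourier coefficients of [A] and [B] is at least [1 / 2K].
    The character splits [A] and [B] into majority parts [A0], [B0] and
    minority parts [A1], [B1]; since [A0+B0] is disjoint from [A0+B1] and from
    [A1+B0], one of the three pairs has [phi] at most [phi A B].  The bias is at
    least of order [1 / sqrt K], which is what makes this [th] admissible.
    The dimension of [H] drops at each step, so the process stops, with the
    desired density.  As [|A+B| >= (|A||B|)^(1/2)] always holds, [phi] being
    non-increasing bounds the loss of [|A||B|] by [K^(1/th)]. *)

(** * Inequalities for real powers *)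

Lemma powR_bernoulli (R : realType) (x r : R) :
  0 <= x -> 0 <= r <= 1 -> x `^ r <= 1 + r * (x - 1).
Proof.
move=> x0 /andP[r0 r1]; have [->|xn0] := eqVneq x 0.
  have [->|rn0] := eqVneq r 0; first by rewrite powRr0 mul0r addr0.
  by rewrite powR0//; lra.
have xp : 0 < x by rewrite lt_def xn0.
(* [m] is the mean of [x] and [1] with weights [r] and [1 - r]. The bound [ln y <= y - 1] at [x / m]
   and at [1 / m], taken with these weights, has right-hand side zero. *)
set m := 1 + r * (x - 1).
have mp : 0 < m.
  have [/eqP r1'|rn1] := boolP (r == 1); first by rewrite /m r1'; lra.
  have : 0 <= r * x by rewrite mulr_ge0.
  have {}r1 : r < 1 by rewrite lt_neqAle rn1.
  by rewrite /m; lra.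
have ln_le (y : R) : 0 < y -> ln y <= y - 1.
  by move=> yp; have := @le_ln1Dx R (y - 1); rewrite addrCA subrr addr0; apply; lra.
rewrite -ler_ln ?posrE ?powR_gt0// ln_powR.
have h1 := ln_le (x / m) (divr_gt0 xp mp).
have h2 := ln_le m^-1; rewrite invr_gt0 in h2; have {}h2 := h2 mp.
rewrite ln_div ?posrE// in h1; rewrite lnV ?posrE// in h2.
have h3 := ler_wpM2l r0 h1.
have h4 : (1 - r) * - ln m <= (1 - r) * (m^-1 - 1) by rewrite ler_wpM2l// subr_ge0.
have h5 : r * (x / m - 1) + (1 - r) * (m^-1 - 1) = 0.
  have -> : r * (x / m - 1) + (1 - r) * (m^-1 - 1) = m / m - 1 by rewrite /m; ring.
  by rewrite divff ?subrr// gt_eqF.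
lra.
Qed.

Lemma concave_powR (R : realType) (x y l s : R) :
  0 <= x -> 0 <= y -> 0 <= l <= 1 -> 0 < s <= 1 ->
  l * x `^ s + (1 - l) * y `^ s <= (l * x + (1 - l) * y) `^ s.
Proof.
move=> x0 y0 /andP[l0 l1] /andP[s0 s1]; set m := l * x + (1 - l) * y.
have l1' : 0 <= 1 - l by lra.
have lx0 : 0 <= l * x by rewrite mulr_ge0.
have ly0 : 0 <= (1 - l) * y by rewrite mulr_ge0.
have [m0|mn0] := eqVneq m 0.
  have zero (a b : R) : a * b = 0 -> a * b `^ s = 0.
    by move=> /eqP; rewrite mulf_eq0 => /orP[/eqP->|/eqP->];
      rewrite ?mul0r// powR0 ?gt_eqF// mulr0.
  have [e1 e2] : l * x = 0 /\ (1 - l) * y = 0 by split; rewrite /m in m0; lra.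
  by rewrite (zero _ _ e1) (zero _ _ e2) addr0 powR_ge0.
have mp : 0 < m by rewrite lt_def mn0 addr_ge0.
have tangent z : 0 <= z -> z `^ s <= m `^ s * (1 + s * (z / m - 1)).
  move=> z0; rewrite -[in leLHS](divfK mn0 z) powRM ?divr_ge0 ?(ltW mp)//.
  rewrite mulrC ler_wpM2l ?powR_ge0// powR_bernoulli ?divr_ge0 ?(ltW mp)//.
  by rewrite (ltW s0).
have h1 := ler_wpM2l l0 (tangent x x0).
have h2 := ler_wpM2l l1' (tangent y y0).
apply: (le_trans (lerD h1 h2)).
have -> : l * (m `^ s * (1 + s * (x / m - 1))) +
  (1 - l) * (m `^ s * (1 + s * (y / m - 1))) = m `^ s * (1 + s * (m / m - 1)).
  by rewrite /m; ring.
by rewrite divff// subrr mulr0 addr0 mulr1.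
Qed.

(* With [u = 0] or [u = 1, e = 0] this is an equality: the slack available for
   [e > 0] is linear in [1 - u]. *)
Lemma sqr1D_powR_le (R : realType) (u e : R) :
  0 <= u -> 0 <= e <= 2^-1 -> 4 * e <= 1 - u ->
  (1 + u ^+ 2) `^ (1 + e) <= 1 + u `^ (1 + e).
Proof.
move=> u0 /andP[e0 e1] eu.
have e01 : 0 <= e <= 1 by apply/andP; split; lra.
have [->|un0] := eqVneq u 0.
  by rewrite expr0n addr0 powR1 lerDl powR_ge0.
have up : 0 < u by rewrite lt_def un0.
have u2 : 0 <= u ^+ 2 by rewrite sqr_ge0.
have u21 : u ^+ 2 <= 1 by rewrite expr_le1//; lra.
rewrite !powRD ?gt_eqF ?implybT//; try lra.
rewrite !powRr1//; last lra.
have h1 : (1 + u ^+ 2) `^ e <= 1 + e * u ^+ 2.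
  have /(_ _ e01) := @powR_bernoulli R (1 + u ^+ 2) e.
  by rewrite [1 + u ^+ 2 - 1]addrAC subrr add0r; apply; lra.
have dp : 0 < u + e * (1 - u) by rewrite ltr_pwDl// mulr_ge0//; lra.
(* A lower bound is needed here, so Bernoulli is applied to [1 / u] and inverted. *)
have h2 : u / (u + e * (1 - u)) <= u `^ e.
  have h := @powR_bernoulli R u^-1 e; rewrite invr_ge0 in h.
  have {}h := h u0 e01.
  rewrite -(powR_inv1 u0) -powRrM mulN1r powRN (powR_inv1 u0) in h.
  rewrite -[leRHS]invrK -[leLHS]invrK lef_pV2 ?posrE ?invr_gt0 ?divr_gt0 ?powR_gt0//.
  rewrite (le_trans h)// invf_div [leRHS]mulrDl divff// -mulrA lerD2l.
  by rewrite mulrBl divff// mul1r.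
have h3 : (1 + u ^+ 2) * (1 + u ^+ 2) `^ e <= (1 + u ^+ 2) * (1 + e * u ^+ 2).
  by rewrite ler_wpM2l//; lra.
have h4 : u * (u / (u + e * (1 - u))) <= u * u `^ e by rewrite ler_wpM2l.
apply: (le_trans h3); apply: le_trans (lerD (lexx 1) h4).
have -> : (1 + u ^+ 2) * (1 + e * u ^+ 2) = 1 + u ^+ 2 * (1 + e + e * u ^+ 2) by ring.
rewrite lerD2l mulrA -expr2 ler_wpM2l// -[leRHS]mul1r ler_pdivlMr//.
have : e * u ^+ 2 <= e by rewrite ler_piMr.
have : 0 <= e * u ^+ 2 by rewrite mulr_ge0.
nra.
Qed.

(** Here [p] and [q] are the majority proportions of the two sets. As [q] lies between [1 - p] and
    [p], concavity reduces the claim to [q = p], a statement in the single ratio [(1 - p) / p]. *)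
Lemma powR_split_ge1 (R : realType) (th p q : R) :
  0 < th -> 2^-1 <= q -> q <= p -> p <= 1 -> 16 * th <= 2 * p - 1 ->
  1 <= p `^ (2^-1 + th) * (q `^ (2^-1 + th) + (1 - q) `^ (2^-1 + th)).
Proof.
move=> th0 q2 qp p1 thp; set s := 2^-1 + th.
have s0 : 0 < s by rewrite /s; lra.
have s1 : s <= 1 by rewrite /s; lra.
have p0 : 0 < p by lra.
have pn0 : p != 0 by rewrite gt_eqF.
have conc : p `^ s + (1 - p) `^ s <= q `^ s + (1 - q) `^ s.
  have d0 : 0 < 2 * p - 1 by lra.
  (* The weight for which [q = l p + (1 - l) (1 - p)]; exchanging the weights gives [1 - q]. *)
  pose l := (q - (1 - p)) / (2 * p - 1).
  have l01 : 0 <= l <= 1.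
    by rewrite /l divr_ge0 ?ler_pdivrMr//=; lra.
  have l01' : 0 <= 1 - l <= 1 by lra.
  have s01 : 0 < s <= 1 by rewrite s0.
  have q1 : 0 <= 1 - p by lra.
  have h1 := concave_powR (ltW p0) q1 l01 s01.
  have h2 := concave_powR (ltW p0) q1 l01' s01.
  have e : l * (2 * p - 1) = q - (1 - p) by rewrite divfK// gt_eqF.
  have e1 : l * p + (1 - l) * (1 - p) = q by lra.
  have e2 : (1 - l) * p + (1 - (1 - l)) * (1 - p) = 1 - q by lra.
  rewrite e1 in h1; rewrite e2 in h2; lra.
apply: le_trans (ler_wpM2l (powR_ge0 p s) conc).
(* Divided by [p^(2s)], the claim at [q = p] reads [(1 + t)^(2s) <= 1 + t^s]. *)
set t := (1 - p) / p; have t0 : 0 <= t by rewrite divr_ge0//; lra.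
have tE : p * t = 1 - p by rewrite mulrC divfK.
have ep : p^-1 = 1 + t by rewrite /t mulrBl divff// mul1r; lra.
set u := Num.sqrt t.
have uu : u ^+ 2 = t by rewrite sqr_sqrtr.
have u0 : 0 <= u by rewrite sqrtr_ge0.
have ts : t `^ s = u `^ (1 + 2 * th).
  by rewrite /u -powR12_sqrt// -powRrM; congr powR; rewrite /s; field.
(* This is the slack [4 e <= 1 - u] of [sqr1D_powR_le] at [e = 2 th], and the source of the constant
   16 in the bias hypothesis. *)
have ub : u <= 1 - 8 * th.
  rewrite -(ler_pXn2r (n := 2)) ?nnegrE//; last by lra.
  rewrite uu ler_pdivrMr//.
  have : 0 <= th * (2 * p - 1) by rewrite mulr_ge0 ?(ltW th0)//; lra.
  have : 0 <= th ^+ 2 * p by rewrite mulr_ge0// ?sqr_ge0// ltW.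
  have : 0 <= th * (1 - p) by rewrite mulr_ge0 ?(ltW th0)//; lra.
  nra.
have e01 : 0 <= 2 * th <= 2^-1 by lra.
have eu : 4 * (2 * th) <= 1 - u by lra.
have key := sqr1D_powR_le u0 e01 eu.
rewrite uu -ts -ep in key.
have e2 : (1 - p) `^ s = p `^ s * t `^ s by rewrite -powRM ?(ltW p0)// tE.
rewrite e2 -[X in X + _]mulr1 -mulrDr mulrA.
have ps : p `^ s * p `^ s = p `^ (1 + 2 * th).
  by rewrite -powRD ?pn0 ?implybT//; congr powR; rewrite /s; field.
rewrite ps; apply: le_trans (ler_wpM2l (powR_ge0 p _) key).
by rewrite -powRM ?invr_ge0 ?(ltW p0)// divff// powR1.
Qed.

(** The last hypothesis says that the [a] side is the more biased one. The product of the biases is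
    at least [(16 th)^2], so the larger bias [2 p - 1] is at least [16 th]. The minority part that
    enters is the one of the less biased side. *)
Lemma split_ineq_aux (R : realType) (th a0 a1 b0 b1 : R) :
  0 < th -> 0 < a0 -> 0 < b0 -> 0 <= a1 -> 0 <= b1 <= b0 ->
  (16 * th) ^+ 2 * ((a0 + a1) * (b0 + b1)) <= (a0 - a1) * (b0 - b1) ->
  a1 * b0 <= b1 * a0 ->
  ((a0 + a1) * (b0 + b1)) `^ (2^-1 + th) <=
    (a0 * b0) `^ (2^-1 + th) + (a0 * b1) `^ (2^-1 + th).
Proof.
move=> th0 a0p b0p a1p /andP[b1p b10] big ratio.
set a := a0 + a1; set b := b0 + b1; set s := 2^-1 + th.
have ap : 0 < a by rewrite /a; lra.
have bp : 0 < b by rewrite /b; lra.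
have [an0 bn0] : a != 0 /\ b != 0 by rewrite !gt_eqF.
pose p := a0 / a; pose q := b0 / b.
have pE : a0 = p * a by rewrite divfK.
have qE : b0 = q * b by rewrite divfK.
have a1E : a1 = (1 - p) * a by rewrite mulrBl -pE /a; ring.
have b1E : b1 = (1 - q) * b by rewrite mulrBl -qE /b; ring.
have [p0 q0] : 0 <= p /\ 0 <= q by split; rewrite divr_ge0// ltW.
have p1 : p <= 1 by rewrite ler_pdivrMr// /a; lra.
have q1 : q <= 1 by rewrite ler_pdivrMr// /b; lra.
have q2 : 2^-1 <= q by rewrite ler_pdivlMr// /b; lra.
have qp : q <= p.
  rewrite ler_pdivrMr// mulrAC ler_pdivlMr// /a /b; lra.
have thp : 16 * th <= 2 * p - 1.
  have abp : 0 < a * b by rewrite mulr_gt0.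
  have : (16 * th) ^+ 2 <= (2 * p - 1) * (2 * q - 1).
    rewrite -(ler_pM2r abp); apply: (le_trans big).
    by rewrite [in leLHS]pE [in leLHS]a1E [in leLHS]qE [in leLHS]b1E; nra.
  move=> h; rewrite -(ler_pXn2r (n := 2)) ?nnegrE//; try lra.
  apply: (le_trans h); rewrite expr2 ler_wpM2l//; lra.
have key := powR_split_ge1 th0 q2 qp p1 thp.
clearbody p q; rewrite -/s in key *; rewrite [in leRHS]pE [in leRHS]qE b1E.
rewrite !powRM ?mulr_ge0 ?subr_ge0 ?(ltW ap) ?(ltW bp)//.
have h := ler_wpM2l (mulr_ge0 (powR_ge0 a s) (powR_ge0 b s)) key.
rewrite mulr1 in h; apply: (le_trans h); rewrite le_eqVlt; apply/orP; left.
by apply/eqP; ring.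
Qed.

Lemma split_ineq (R : realType) (th a0 a1 b0 b1 : R) :
  0 < th -> 0 < a0 -> 0 < b0 -> 0 <= a1 <= a0 -> 0 <= b1 <= b0 ->
  (16 * th) ^+ 2 * ((a0 + a1) * (b0 + b1)) <= (a0 - a1) * (b0 - b1) ->
  ((a0 + a1) * (b0 + b1)) `^ (2^-1 + th) <=
    (a0 * b0) `^ (2^-1 + th) +
    Num.max ((a0 * b1) `^ (2^-1 + th)) ((a1 * b0) `^ (2^-1 + th)).
Proof.
move=> th0 a0p b0p a1p b1p big; have [/andP[a1p' _] /andP[b1p' _]] := (a1p, b1p).
have [r|/ltW r] := leP (a1 * b0) (b1 * a0).
  apply: le_trans (split_ineq_aux th0 a0p b0p a1p' b1p big r) _.
  by rewrite lerD2l le_max lexx.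
have big' : (16 * th) ^+ 2 * ((b0 + b1) * (a0 + a1)) <= (b0 - b1) * (a0 - a1).
  by rewrite [X in _ * X]mulrC [leRHS]mulrC.
rewrite [(a0 + a1) * _]mulrC.
apply: le_trans (split_ineq_aux th0 b0p a0p b1p' a1p big' r) _.
by rewrite [b0 * a0]mulrC [b0 * a1]mulrC lerD2l le_max lexx orbT.
Qed.

(** * Characters and the Fourier transform on the binary space *)

Lemma F2_eq01 (x : 'F_2) : (x == 0) || (x == 1).
Proof. by case: x => [[|[|m]]]. Qed.

Definition chi (R : realType) (n : nat) (xi v : 'rV['F_2]_n) : R :=
  if (v *m xi^T) 0 0 == 0 then 1 else -1.
Arguments chi R {n} xi v.

Lemma chiD (R : realType) (n : nat) (xi u v : 'rV['F_2]_n) :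
  chi R xi (u + v) = chi R xi u * chi R xi v.
Proof.
rewrite /chi mulmxDl mxE; case/orP: (F2_eq01 ((u *m xi^T) 0 0)) => /eqP->;
case/orP: (F2_eq01 ((v *m xi^T) 0 0)) => /eqP->;
by rewrite /= ?mulr1 ?mul1r ?mulrNN ?mulr1.
Qed.

Lemma chi_sym (R : realType) (n : nat) (xi v : 'rV['F_2]_n) :
  chi R xi v = chi R v xi.
Proof.
by rewrite /chi -[v *m xi^T]trmxK trmx_mul trmxK mxE.
Qed.

Lemma chiP (R : realType) (n : nat) (xi v : 'rV['F_2]_n) :
  (chi R xi v == 1) || (chi R xi v == -1).
Proof. by rewrite /chi; case: ifP; rewrite eqxx ?orbT. Qed.

Lemma chi_sqr (R : realType) (n : nat) (xi v : 'rV['F_2]_n) :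
  chi R xi v * chi R xi v = 1.
Proof. by case/orP: (chiP R xi v) => /eqP->; rewrite ?mulrNN mulr1. Qed.

Lemma norm_chi (R : realType) (n : nat) (xi v : 'rV['F_2]_n) :
  `|chi R xi v| = 1.
Proof. by case/orP: (chiP R xi v) => /eqP->; rewrite ?normrN normr1. Qed.

Lemma rV_F2_addvv (n : nat) (v : 'rV['F_2]_n) : v + v = 0.
Proof.
apply/rowP => i; rewrite !mxE.
by case/orP: (F2_eq01 (v 0 i)) => /eqP->; apply/eqP.
Qed.

Definition ft (R : realType) (n : nat) (A : {set 'rV['F_2]_n})
  (xi : 'rV['F_2]_n) : R := \sum_(a in A) chi R xi a.
Arguments ft R {n} A xi.

(** Translation by [h0] permutes [H] and flips the sign of every term. *)
Lemma ft_vspace_eq0 (R : realType) (n : nat) (H : {vspace 'rV['F_2]_n})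
  (xi h0 : 'rV['F_2]_n) :
  h0 \in H -> chi R xi h0 = -1 -> ft R (vspace_set H) xi = 0.
Proof.
move=> h0H c; have e : ft R (vspace_set H) xi = - ft R (vspace_set H) xi.
  rewrite {1}/ft (reindex_inj (addIr h0)) /= -sumrN; apply: eq_big => [h|h _].
    by rewrite !inE rpredDr.
  by rewrite chiD c mulrN1.
lra.
Qed.

Lemma sum_chi (R : realType) (n : nat) (v : 'rV['F_2]_n) :
  \sum_xi chi R xi v = if v == 0 then #|{: 'rV['F_2]_n}|%:R else 0.
Proof.
case: eqVneq => [->|vn0].
  under eq_bigr do rewrite /chi mul0mx mxE eqxx.
  by rewrite sumr_const.
(* By symmetry of the pairing the sum is the transform of the whole space at [v]; a unit vector at a
   nonzero coordinate of [v] makes it vanish. *)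
have /rV0Pn[i vi] := vn0.
have c : chi R v (delta_mx 0 i) = -1.
  by rewrite /chi -rowE !mxE (negPf vi).
under eq_bigr do rewrite chi_sym.
rewrite -[RHS](ft_vspace_eq0 (memvf (delta_mx 0 i)) c).
by apply: eq_bigl => h; rewrite !inE memvf.
Qed.

Lemma parseval (R : realType) (n : nat) (f : 'rV['F_2]_n -> R) :
  \sum_xi (\sum_v f v * chi R xi v) ^+ 2 =
  #|{: 'rV['F_2]_n}|%:R * \sum_v f v ^+ 2.
Proof.
under eq_bigr do rewrite expr2 big_distrlr /=.
rewrite exchange_big /= mulr_sumr; apply: eq_bigr => u _.
rewrite exchange_big /= (bigD1 u)//= [X in _ + X]big1 ?addr0 => [|v vu].
  under eq_bigr do rewrite mulrACA chi_sqr mulr1.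
  by rewrite sumr_const -expr2 mulr_natl.
under eq_bigr do rewrite mulrACA -chiD.
rewrite -mulr_sumr sum_chi ifF ?mulr0//; apply: contra_neqF vu => /eqP uv.
by apply: (addrI u); rewrite uv rV_F2_addvv.
Qed.

Lemma ft_indicator (R : realType) (n : nat) (A : {set 'rV['F_2]_n}) xi :
  ft R A xi = \sum_v (v \in A)%:R * chi R xi v.
Proof.
rewrite /ft big_mkcond; apply: eq_bigr => v _.
by case: (v \in A); rewrite ?mul1r ?mul0r.
Qed.

Lemma parseval_set (R : realType) (n : nat) (A : {set 'rV['F_2]_n}) :
  \sum_xi ft R A xi ^+ 2 = #|{: 'rV['F_2]_n}|%:R * #|A|%:R.
Proof.
under eq_bigr do rewrite ft_indicator.
rewrite parseval; congr (_ * _).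
rewrite -sumr_const [RHS]big_mkcond.
by apply: eq_bigr => v _; case: (v \in A); rewrite ?expr1n ?expr0n.
Qed.

Lemma norm_ft_le (R : realType) (n : nat) (A : {set 'rV['F_2]_n}) xi :
  `|ft R A xi| <= #|A|%:R.
Proof.
apply: (le_trans (ler_norm_sum _ _ _)).
by under eq_bigr do rewrite norm_chi; rewrite sumr_const.
Qed.

Lemma ft0 (R : realType) (n : nat) (A : {set 'rV['F_2]_n}) :
  ft R A 0 = #|A|%:R.
Proof.
rewrite /ft -sumr_const; apply: eq_bigr => a _.
by rewrite /chi trmx0 mulmx0 mxE eqxx.
Qed.

(** The convolution theorem; the inner sum counts the representations of [v] as an element of [A]
    plus an element of [B]. *)
Lemma ft_mul (R : realType) (n : nat) (A B : {set 'rV['F_2]_n}) xi :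
  ft R A xi * ft R B xi =
  \sum_v (\sum_(a in A) (v - a \in B)%:R) * chi R xi v.
Proof.
under [RHS]eq_bigr do rewrite mulr_suml.
rewrite exchange_big /= {1}/ft mulr_suml; apply: eq_bigr => a _.
rewrite ft_indicator mulr_sumr [RHS](reindex_inj (addrI a)) /=.
by apply: eq_bigr => b _; rewrite chiD [a + b]addrC addrK mulrCA.
Qed.

(** * Additive energy and a large Fourier coefficient *)

Lemma sqr_sum_le (R : realType) (T : finType) (S : {set T}) (f : T -> R) :
  (\sum_(v in S) f v) ^+ 2 <= #|S|%:R * \sum_(v in S) f v ^+ 2.
Proof.
set t := \sum_(v in S) f v; set k : R := #|S|%:R; set q := \sum_(v in S) _.
have [k0|k0] := eqVneq #|S| 0%N.
  by rewrite /t /k k0 mul0r (cards0_eq k0) big_set0 expr0n.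
have kp : 0 < k by rewrite ltr0n lt0n.
(* Cauchy-Schwarz as non-negativity of the variance of [f], scaled by [k] to avoid division. *)
have : 0 <= \sum_(v in S) (k * f v - t) ^+ 2 by apply: sumr_ge0 => v _; rewrite sqr_ge0.
have -> : \sum_(v in S) (k * f v - t) ^+ 2 = k * (k * q - t ^+ 2).
  transitivity (\sum_(v in S) (k ^+ 2 * f v ^+ 2 + - (2 * k * t) * f v + t ^+ 2)).
    by apply: eq_bigr => v _; ring.
  rewrite !big_split /= -!mulr_sumr sumr_const -/t -/q -mulr_natr -/k; ring.
by rewrite pmulr_rge0// subr_ge0.
Qed.

(** By Parseval the sum on the right is the additive energy times the size of the space. The
    representation function has total mass [|A||B|] and is supported on [A+B], so Cauchy-Schwarz
    applies. *)
Lemma energy_ge (R : realType) (n : nat) (A B : {set 'rV['F_2]_n}) :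
  #|{: 'rV['F_2]_n}|%:R * (#|A|%:R * #|B|%:R) ^+ 2 <=
  #|sumset A B|%:R * \sum_xi (ft R A xi * ft R B xi) ^+ 2.
Proof.
under eq_bigr do rewrite ft_mul.
rewrite parseval [leRHS]mulrCA ler_wpM2l// -(ft0 R A) -(ft0 R B) ft_mul.
set r := fun v : 'rV['F_2]_n => \sum_(a in A) (v - a \in B)%:R : R.
have rout v : v \notin sumset A B -> r v = 0.
  move=> vS; apply: big1 => a aA; apply/eqP; rewrite pnatr_eq0 eqb0.
  apply: contra vS => vB; apply/imset2P; exists a (v - a) => //.
  by rewrite addrCA subrr addr0.
have -> : \sum_v r v * chi R 0 v = \sum_(v in sumset A B) r v.
  rewrite [RHS]big_mkcond; apply: eq_bigr => v _.
  rewrite /chi trmx0 mulmx0 mxE eqxx mulr1.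
  by case: ifPn => // /rout.
have -> : \sum_v r v ^+ 2 = \sum_(v in sumset A B) r v ^+ 2.
  rewrite [RHS]big_mkcond; apply: eq_bigr => v _.
  by case: ifPn => // /rout ->; rewrite expr0n.
exact: sqr_sum_le.
Qed.

(** Termwise AM-GM followed by Parseval; the weights [a] and [b] give both squares the same
    total. *)
Lemma sum_norm_ft_le (R : realType) (n : nat) (A B : {set 'rV['F_2]_n}) :
  A != set0 -> B != set0 ->
  \sum_xi `|ft R A xi * ft R B xi| <=
  #|{: 'rV['F_2]_n}|%:R * (Num.sqrt #|A|%:R * Num.sqrt #|B|%:R).
Proof.
rewrite -!card_gt0 => A0 B0; set N : R := #|{: _}|%:R.
set a := Num.sqrt _; set b := Num.sqrt _.
have ap : 0 < a by rewrite sqrtr_gt0 ltr0n.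
have bp : 0 < b by rewrite sqrtr_gt0 ltr0n.
have aE : #|A|%:R = a ^+ 2 by rewrite sqr_sqrtr.
have bE : #|B|%:R = b ^+ 2 by rewrite sqr_sqrtr.
have abp : 0 < 2 * (a * b) by rewrite !mulr_gt0.
rewrite -(ler_pM2l abp) mulr_sumr.
have -> : 2 * (a * b) * (N * (a * b)) =
  \sum_xi (b ^+ 2 * ft R A xi ^+ 2 + a ^+ 2 * ft R B xi ^+ 2).
  by rewrite big_split /= -!mulr_sumr !parseval_set aE bE -/N; ring.
apply: ler_sum => xi _; rewrite normrM -(real_normK (num_real (ft R A xi))) -(real_normK (num_real (ft R B xi))).
rewrite -subr_ge0.
have -> : b ^+ 2 * `|ft R A xi| ^+ 2 + a ^+ 2 * `|ft R B xi| ^+ 2 -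
  2 * (a * b) * (`|ft R A xi| * `|ft R B xi|) =
  (b * `|ft R A xi| - a * `|ft R B xi|) ^+ 2 by ring.
exact: sqr_ge0.
Qed.

(** Parseval for [H], whose transform is [|H|] on the annihilator and zero elsewhere. *)
Lemma card_perp (R : realType) (n : nat) (H : {vspace 'rV['F_2]_n}) :
  #|[set xi | [forall h, (h \in H) ==> (chi R xi h == 1)]]|%:R *
    #|vspace_set H|%:R = #|{: 'rV['F_2]_n}|%:R :> R.
Proof.
set P := [set _ | _]; set k : R := #|vspace_set H|%:R.
have kp : 0 < k.
  by rewrite ltr0n card_gt0; apply/set0Pn; exists 0; rewrite inE mem0v.
have ftE xi : ft R (vspace_set H) xi ^+ 2 = if xi \in P then k ^+ 2 else 0.
  rewrite inE; case: ifPn => [/forallP hP|].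
    congr (_ ^+ 2); rewrite /k -sumr_const; apply: eq_bigr => h.
    by rewrite inE => hH; apply/eqP; have := hP h; rewrite hH.
  rewrite negb_forall => /existsP[h]; rewrite negb_imply => /andP[hH cn1].
  rewrite (@ft_vspace_eq0 _ _ _ _ h) ?expr0n//.
  by have := chiP R xi h; rewrite (negPf cn1) => /eqP.
have := parseval_set R (vspace_set H).
under eq_bigr do rewrite ftE.
rewrite -big_mkcond /= sumr_const -[LHS]mulr_natl -/k expr2 mulrA.
by move/(mulIf (lt0r_neq0 kp)).
Qed.

Lemma exists_large_coeff (R : realType) (n : nat) (K : R)
  (A B : {set 'rV['F_2]_n}) (H : {vspace 'rV['F_2]_n}) :
  0 < K -> A != set0 -> B != set0 ->
  #|sumset A B|%:R <= K * (Num.sqrt #|A|%:R * Num.sqrt #|B|%:R) ->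
  Num.sqrt #|A|%:R * Num.sqrt #|B|%:R < (2 * K)^-1 * #|vspace_set H|%:R ->
  exists xi h0, [/\ h0 \in H, chi R xi h0 = -1 &
    (2 * K)^-1 * (#|A|%:R * #|B|%:R) <= `|ft R A xi| * `|ft R B xi|].
Proof.
move=> K0 An0 Bn0 AB lt.
set e := _ * (#|A|%:R * #|B|%:R).
have [/existsP[xi /existsP[h0 /and3P[hH /eqP c le]]]|none] := boolP
  [exists xi, exists h0, [&& h0 \in H, chi R xi h0 == -1 &
     e <= `|ft R A xi| * `|ft R B xi|]].
  by exists xi, h0.
exfalso; move: lt; apply/negP; rewrite -leNgt.
(* [P] is the annihilator of [H]; summing over all characters of the ambient
   space instead of those of [H] only repeats each term [#|P|] times. *)
set P := [set xi | [forall h, (h \in H) ==> (chi R xi h == 1)]].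
have small xi : xi \notin P -> `|ft R A xi| * `|ft R B xi| <= e.
  rewrite inE negb_forall => /existsP[h]; rewrite negb_imply => /andP[hH cn1].
  move: none; rewrite negb_exists => /forallP/(_ xi).
  rewrite negb_exists => /forallP/(_ h); rewrite hH /=.
  by have := chiP R xi h; rewrite (negPf cn1) /= => -> /=; rewrite -ltNge => /ltW.
have N_eq := card_perp R H; rewrite -/P in N_eq.
set M := Num.sqrt _ * _ in AB *.
have M2 : #|A|%:R * #|B|%:R = M ^+ 2 by rewrite /M exprMn !sqr_sqrtr.
have Mp : 0 < M by rewrite mulr_gt0// sqrtr_gt0 ltr0n card_gt0.
set N : R := #|{: _}|%:R in N_eq.
have Np : 0 < N by rewrite ltr0n; apply/card_gt0P; exists 0.
set h : R := #|vspace_set H|%:R in N_eq *; set p : R := #|P|%:R in N_eq.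
have e0 : 0 <= e by rewrite /e mulr_ge0// ?mulr_ge0// invr_ge0 mulr_ge0// ltW.
(* Characters in [P] get the trivial bound; for the others one factor is bounded by [e] and the
   remaining one is summed in absolute value. *)
have up : \sum_xi (ft R A xi * ft R B xi) ^+ 2 <= p * (M ^+ 2) ^+ 2 + e * (N * M).
  apply: (@le_trans _ _ (\sum_xi ((if xi \in P then (M ^+ 2) ^+ 2 else 0) +
     e * `|ft R A xi * ft R B xi|))).
    apply: ler_sum => xi _; rewrite -(real_normK (num_real (ft R A xi * ft R B xi))).
    case: ifPn => [_|/small le].
      apply: ler_wpDr; first exact: mulr_ge0.
      rewrite ler_pXn2r ?nnegrE// ?sqr_ge0// -M2 normrM.
      by rewrite ler_pM// norm_ft_le.
    by rewrite add0r expr2 ler_wpM2r// normrM.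
  rewrite big_split /= -big_mkcond /= sumr_const -mulr_natl lerD2l -mulr_sumr.
  by rewrite ler_wpM2l// sum_norm_ft_le.
have low := energy_ge R A B; rewrite M2 -/N in low.
have := le_trans low (ler_pM (ler0n _ _) (sumr_ge0 _ (fun i _ => sqr_ge0 _)) AB up).
have pp : 0 < p.
  rewrite lt_def ler0n andbT; apply: contraTneq Np => p0.
  by rewrite -N_eq p0 mul0r ltxx.
rewrite /e M2 -N_eq.
(* After cancelling [p M^4] the comparison reads [h <= K M + h / 2], contradicting
   [M < h / (2K)]. *)
have -> : K * M * (p * (M ^+ 2) ^+ 2 + (2 * K)^-1 * M ^+ 2 * (p * h * M)) =
   (p * (M ^+ 2) ^+ 2) * (K * M + h / 2) by field; rewrite gt_eqF.
have -> : p * h * (M ^+ 2) ^+ 2 = (p * (M ^+ 2) ^+ 2) * h by ring.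
rewrite ler_pM2l; last by rewrite mulr_gt0 ?exprn_gt0.
move=> hh.
rewrite mulrC ler_pdivrMr ?mulr_gt0//; lra.
Qed.

(** * Splitting a coset along a hyperplane *)

Lemma eqN11 (R : realType) : (-1 == 1 :> R) = false.
Proof. by rewrite lt_eqF//; lra. Qed.

Lemma mem_translate (V : finZmodType) (x v : V) (H : {set V}) :
  (v \in translate x H) = (v - x \in H).
Proof.
apply/imsetP/idP => [[h hH ->]|vx]; first by rewrite addrAC subrr add0r.
by exists (v - x) => //; rewrite addrC subrK.
Qed.

Lemma rV_F2_oppv (n : nat) (v : 'rV['F_2]_n) : - v = v.
Proof. by apply/eqP; rewrite eq_sym -addr_eq0 rV_F2_addvv. Qed.

Definition hyperplane (n : nat) (H : {vspace 'rV['F_2]_n}) (xi : 'rV['F_2]_n) :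
  {vspace 'rV['F_2]_n} :=
  (H :&: lker (linfun (mulmxr xi^T : 'rV['F_2]_n -> 'rV['F_2]_1)))%VS.

Lemma mem_hyperplane (R : realType) (n : nat) (H : {vspace 'rV['F_2]_n}) xi v :
  (v \in hyperplane H xi) = (v \in H) && (chi R xi v == 1).
Proof.
rewrite memv_cap memv_ker lfunE /=; congr (_ && _); rewrite /chi.
have -> : (v *m xi^T == 0) = ((v *m xi^T) 0 0 == 0).
  apply/eqP/eqP => [->|e]; first by rewrite mxE.
  by apply/matrixP => i j; rewrite !ord1 e mxE.
by case: ifP; rewrite ?eqxx ?eqN11.
Qed.

Lemma dim_hyperplane (R : realType) (n : nat) (H : {vspace 'rV['F_2]_n}) xi h0 :
  h0 \in H -> chi R xi h0 = -1 -> (\dim (hyperplane H xi) < \dim H)%N.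
Proof.
move=> hH c; rewrite ltn_neqAle dimvS ?capvSl// andbT.
apply: contraPneq hH => d.
have /eqP <- : hyperplane H xi == H by rewrite eqEdim capvSl d leqnn.
by rewrite (mem_hyperplane R) c eqN11 andbF.
Qed.

(** The level sets of the character on [x + H] are two cosets of the hyperplane. [e] is its value on
    the majority part, so the coefficient of [A'] is [e (|A0| - |A1|)]. *)
Lemma hyperplane_split (R : realType) (n : nat) (A : {set 'rV['F_2]_n})
  (H : {vspace 'rV['F_2]_n}) (x xi h0 : 'rV['F_2]_n) :
  h0 \in H -> chi R xi h0 = -1 ->
  let A' := A :&: translate x (vspace_set H) in
  exists (x0 x1 : 'rV['F_2]_n) (e : R),
  let A0 := A :&: translate x0 (vspace_set (hyperplane H xi)) in
  let A1 := A :&: translate x1 (vspace_set (hyperplane H xi)) in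
  [/\ `|e| = 1, {in A0, forall a, chi R xi a = e},
      {in A1, forall a, chi R xi a = - e} &
      [/\ A0 \subset A', A1 \subset A', #|A'| = (#|A0| + #|A1|)%N,
      (#|A1| <= #|A0|)%N & `|ft R A' xi| = #|A0|%:R - #|A1|%:R]].
Proof.
move=> hH c A'.
pose X e := [set a in A' | chi R xi a == e].
have n1 : (-1 == 1 :> R) = false by rewrite eqN11.
have piece e : (e == 1) || (e == -1) -> exists z,
    A :&: translate z (vspace_set (hyperplane H xi)) = X e.
  (* One of [x] and [x + h0] has sign [e], since [h0] flips it. *)
  move=> he; have [z zx ze] : exists2 z, z - x \in H & chi R xi z = e.
    have [/eqP <-|ne] := boolP (chi R xi x == e).
      by exists x => //; rewrite subrr mem0v.
    exists (x + h0); first by rewrite addrAC subrr add0r.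
    rewrite chiD c; move: ne he; case/orP: (chiP R xi x) => /eqP->;
    by move=> ne /orP[]/eqP ee; move: ne; rewrite ee ?eqxx// => _; rewrite ?mulrNN ?mul1r ?mulr1.
  exists z; apply/setP => a; rewrite !inE !mem_translate !inE (mem_hyperplane R).
  have -> : (a - z \in H) = (a - x \in H).
    have -> : a - x = a - z + (z - x) by rewrite addrA subrK.
    by rewrite [RHS]rpredDr.
  have -> : (chi R xi (a - z) == 1) = (chi R xi a == e).
    rewrite -ze rV_F2_oppv.
    rewrite chiD; case/orP: (chiP R xi a) => /eqP->; case/orP: (chiP R xi z) => /eqP->;
    by rewrite ?mulrNN ?mulr1 ?mul1r ?eqxx ?n1// eq_sym n1.
  by rewrite -andbA.
have chi_neq e a : (e == 1) || (e == -1) -> (chi R xi a != e) = (chi R xi a == - e).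
  by case/orP=> /eqP->; case/orP: (chiP R xi a) => /eqP->;
    rewrite ?opprK ?eqxx ?n1// eq_sym n1.
have cardX e : (e == 1) || (e == -1) -> #|A'| = (#|X e| + #|X (- e)%R|)%N.
  move=> he; rewrite -!sum1_card (bigID (fun a => chi R xi a == e)) /=.
  by congr (_ + _)%N; apply: eq_bigl => a; rewrite [in RHS]inE ?chi_neq.
have ftX e : (e == 1) || (e == -1) -> ft R A' xi = e * (#|X e|%:R - #|X (- e)|%:R).
  move=> he; rewrite /ft (bigID (fun a => chi R xi a == e)) /=.
  rewrite mulrBr !mulr_natr -mulNrn -!sumr_const; congr (_ + _).
    by apply: eq_big => [a|a /andP[_ /eqP //]]; rewrite [in RHS]inE.
  apply: eq_big => [a|a]; first by rewrite [in RHS]inE chi_neq.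
  by rewrite chi_neq// => /andP[_ /eqP].
pose e : R := if (#|X (-1)%R| <= #|X 1%R|)%N then 1 else -1.
have he : (e == 1) || (e == -1) by rewrite /e; case: ifP; rewrite eqxx ?orbT.
have hNe : (- e == 1) || (- e == -1).
  by rewrite !eqr_oppLR opprK orbC.
have [x0 X0] := piece e he; have [x1 X1] := piece (- e) hNe.
exists x0, x1, e => /=; rewrite X0 X1.
have ne : `|e| = 1 by case/orP: he => /eqP->; rewrite ?normrN normr1.
have le : (#|X (- e)%R| <= #|X e|)%N.
  by rewrite /e; case: ifP => //; rewrite opprK => /negbT; rewrite -ltnNge => /ltnW.
split=> //; [| |split => //].
- by move=> a; rewrite inE => /andP[_ /eqP].
- by move=> a; rewrite inE => /andP[_ /eqP].
- by apply/subsetP => a; rewrite inE => /andP[].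
- by apply/subsetP => a; rewrite inE => /andP[].
- exact: cardX.
- by rewrite (ftX e)// normrM ne mul1r ger0_norm// subr_ge0 ler_nat.
Qed.

(** * Sumsets, the quantity [phi] and its descent *)

Lemma sumsetC (V : finZmodType) (A B : {set V}) : sumset A B = sumset B A.
Proof.
by apply/setP => v; apply/imset2P/imset2P => -[a b aA bB ->];
  exists b a; rewrite // addrC.
Qed.

Lemma leq_card_sumset (V : finZmodType) (A B : {set V}) :
  B != set0 -> (#|A| <= #|sumset A B|)%N.
Proof.
case/set0Pn=> b bB; rewrite -(card_imset (mem A) (addIr b)).
by apply/subset_leq_card/subsetP => _ /imsetP[a aA ->]; apply: imset2_f.
Qed.

Lemma sqrt_card_le_sumset (R : realType) (V : finZmodType) (A B : {set V}) :
  A != set0 -> B != set0 ->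
  Num.sqrt #|A|%:R * Num.sqrt #|B|%:R <= #|sumset A B|%:R :> R.
Proof.
move=> An0 Bn0; rewrite -[leRHS]sqr_sqrtr// expr2.
apply: ler_pM; rewrite ?sqrtr_ge0// ler_sqrt// ler_nat.
  exact: leq_card_sumset.
by rewrite sumsetC leq_card_sumset.
Qed.

(** The character equals [e f] on [A0+B0] and [- e f] on [A0+B1], so these sumsets are disjoint. *)
Lemma card_sumset_split (R : realType) (n : nat) (xi : 'rV['F_2]_n) (e f : R)
  (A B A0 B0 B1 : {set 'rV['F_2]_n}) :
  `|e| = 1 -> `|f| = 1 -> {in A0, forall a, chi R xi a = e} ->
  {in B0, forall b, chi R xi b = f} -> {in B1, forall b, chi R xi b = - f} ->
  A0 \subset A -> B0 \subset B -> B1 \subset B ->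
  (#|sumset A0 B0| + #|sumset A0 B1| <= #|sumset A B|)%N.
Proof.
move=> ne nf cA c0 c1 sA s0 s1.
have sub (X : {set 'rV['F_2]_n}) : X \subset B -> sumset A0 X \subset sumset A B.
  move=> sX; apply/subsetP => _ /imset2P[a b aA bB ->].
  by apply: imset2_f; [apply: (subsetP sA)|apply: (subsetP sX)].
rewrite -cardsUI (_ : _ :&: _ = set0) ?cards0 ?addn0.
  by rewrite subset_leq_card// subUset !sub.
apply/setP => v; rewrite !inE; apply/negbTE/negP => /andP[].
case/imset2P=> a b aA bB -> /imset2P[a' b' aA' bB' /(congr1 (chi R xi))].
rewrite !chiD (cA _ aA) (cA _ aA') (c0 _ bB) (c1 _ bB') => h.
have ef0 : e * f = 0 by lra.
have : `|e * f| = 1 by rewrite normrM ne nf mulr1.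
by rewrite ef0 normr0; apply/eqP; rewrite eq_sym oner_eq0.
Qed.

Definition phi (R : realType) (n : nat) (th : R) (A B : {set 'rV['F_2]_n}) : R :=
  #|sumset A B|%:R / (#|A|%:R * #|B|%:R) `^ (2^-1 + th).

Lemma phi_ge0 (R : realType) (n : nat) (th : R) (A B : {set 'rV['F_2]_n}) :
  0 <= phi th A B.
Proof. by rewrite divr_ge0// powR_ge0. Qed.

Lemma phi_le (R : realType) (n : nat) (th c : R) (A B : {set 'rV['F_2]_n}) :
  A != set0 -> B != set0 ->
  (phi th A B <= c) =
  (#|sumset A B|%:R <= c * (#|A|%:R * #|B|%:R) `^ (2^-1 + th)).
Proof.
move=> An0 Bn0; rewrite /phi ler_pdivrMr// powR_gt0//.
by rewrite mulr_gt0// ltr0n card_gt0.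
Qed.

Lemma phi_mul (R : realType) (n : nat) (th : R) (A B : {set 'rV['F_2]_n}) :
  A != set0 -> B != set0 ->
  phi th A B * (#|A|%:R * #|B|%:R) `^ th *
    (Num.sqrt #|A|%:R * Num.sqrt #|B|%:R) = #|sumset A B|%:R.
Proof.
move=> An0 Bn0; rewrite -sqrtrM// -powR12_sqrt ?mulr_ge0//.
have p : 0 < #|A|%:R * #|B|%:R :> R by rewrite mulr_gt0// ltr0n card_gt0.
rewrite -mulrA -powRD; last by rewrite (gt_eqF p) implybT.
by rewrite [th + _]addrC /phi divfK// gt_eqF// powR_gt0.
Qed.

(** In this form the doubling bound visibly survives the descent: neither [phi] nor [|A||B|]
    increases. *)
Lemma doubling_phi (R : realType) (n : nat) (th K : R) (A B : {set 'rV['F_2]_n}) :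
  A != set0 -> B != set0 ->
  (#|sumset A B|%:R <= K * (Num.sqrt #|A|%:R * Num.sqrt #|B|%:R)) =
  (phi th A B * (#|A|%:R * #|B|%:R) `^ th <= K).
Proof.
move=> An0 Bn0; rewrite -(phi_mul th An0 Bn0) ler_pM2r//.
by rewrite mulr_gt0// sqrtr_gt0 ltr0n card_gt0.
Qed.

Lemma phi_descent_step (R : realType) (n : nat) (th K : R)
  (A B : {set 'rV['F_2]_n}) (H : {vspace 'rV['F_2]_n}) (x y xi h0 : 'rV['F_2]_n) :
  let A' := A :&: translate x (vspace_set H) in
  let B' := B :&: translate y (vspace_set H) in
  0 < th -> (16 * th) ^+ 2 <= (2 * K)^-1 ->
  A' != set0 -> B' != set0 -> h0 \in H -> chi R xi h0 = -1 ->
  (2 * K)^-1 * (#|A'|%:R * #|B'|%:R) <= `|ft R A' xi| * `|ft R B' xi| ->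
  exists x' y',
  let A'' := A :&: translate x' (vspace_set (hyperplane H xi)) in
  let B'' := B :&: translate y' (vspace_set (hyperplane H xi)) in
  [/\ A'' != set0, B'' != set0, A'' \subset A', B'' \subset B' &
      phi th A'' B'' <= phi th A' B'].
Proof.
have lin (s0 s1 t p q : R) : s0 + s1 <= t -> t <= p + q -> p < s0 -> s1 < q by lra.
move=> A' B' th0 thK A'n0 B'n0 h0H c big.
have [x0 [x1 [e [ne cA0 cA1 [sA0 sA1 cardA leA ftA]]]]] := hyperplane_split A x h0H c.
have [y0 [y1 [f [nf cB0 cB1 [sB0 sB1 cardB leB ftB]]]]] := hyperplane_split B y h0H c.
rewrite -/A' -/B' /= in sA0 sA1 cardA leA ftA sB0 sB1 cardB leB ftB *.
set A0 := A :&: translate x0 _ in cA0 sA0 cardA leA ftA *.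
set A1 := A :&: translate x1 _ in cA1 sA1 cardA leA ftA *.
set B0 := B :&: translate y0 _ in cB0 sB0 cardB leB ftB *.
set B1 := B :&: translate y1 _ in cB1 sB1 cardB leB ftB *.
have majority (X Y : {set 'rV['F_2]_n}) k :
    (0 < k)%N -> k = (#|X| + #|Y|)%N -> (#|Y| <= #|X|)%N -> X != set0.
  rewrite -card_gt0 => k0 kE; apply: contraTT.
  by rewrite -leqNgt leqn0 => /eqP X0; move: k0; rewrite kE X0 -ltnNge.
have A0n0 : A0 != set0 by apply: majority cardA leA; rewrite card_gt0.
have B0n0 : B0 != set0 by apply: majority cardB leB; rewrite card_gt0.
have S01 := card_sumset_split ne nf cA0 cB0 cB1 sA0 sB0 sB1.
have S10 := card_sumset_split nf ne cB0 cA0 cA1 sB0 sA0 sA1.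
rewrite ![sumset B0 _]sumsetC [sumset B' _]sumsetC in S10.
rewrite -(ler_nat R) natrD in S01; rewrite -(ler_nat R) natrD in S10.
set s := 2^-1 + th; have sn0 : s != 0 by rewrite gt_eqF// /s; lra.
have split : (#|A'|%:R * #|B'|%:R) `^ s <= (#|A0|%:R * #|B0|%:R) `^ s +
    Num.max ((#|A0|%:R * #|B1|%:R) `^ s) ((#|A1|%:R * #|B0|%:R) `^ s) :> R.
  rewrite cardA cardB !natrD; apply: split_ineq => //.
  - by rewrite ltr0n card_gt0.
  - by rewrite ltr0n card_gt0.
  - by rewrite ler0n ler_nat.
  - by rewrite ler0n ler_nat.
  - rewrite -!natrD -cardA -cardB -ftA -ftB; apply: le_trans big.
    by rewrite ler_wpM2r ?mulr_ge0.
(* If [A0+B0] is too large for its pair, disjointness inside [A'+B'] leaves little room for the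
   mixed sumset that attains the maximum in [split]. *)
have /orP[le00|lt00] : (phi th A0 B0 <= phi th A' B') ||
    (phi th A' B' * (#|A0|%:R * #|B0|%:R) `^ s < #|sumset A0 B0|%:R).
- by rewrite phi_le// leNgt orNb.
- by exists x0, y0.
have SE : #|sumset A' B'|%:R = phi th A' B' * (#|A'|%:R * #|B'|%:R) `^ s.
  by rewrite /phi divfK// gt_eqF// powR_gt0// mulr_gt0// ltr0n card_gt0.
have := ler_wpM2l (phi_ge0 th A' B') split; rewrite -SE mulrDr.
set u01 := (#|A0|%:R * #|B1|%:R) `^ s; set u10 := (#|A1|%:R * #|B0|%:R) `^ s.
have [_|_] := leP u01 u10 => Sle.
- have lt10 : #|sumset A1 B0|%:R < phi th A' B' * (#|A1|%:R * #|B0|%:R) `^ s.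
    exact: lin S10 Sle lt00.
  have A1n0 : A1 != set0.
    apply: contraTneq lt10 => ->.
    by rewrite cards0 mul0r powR0// mulr0 -leNgt.
  exists x1, y0; split => //; rewrite -/A1 -/B0 phi_le// -/s; exact: ltW.
- have lt01 : #|sumset A0 B1|%:R < phi th A' B' * (#|A0|%:R * #|B1|%:R) `^ s.
    exact: lin S01 Sle lt00.
  have B1n0 : B1 != set0.
    apply: contraTneq lt01 => ->.
    by rewrite cards0 mulr0 powR0// mulr0 -leNgt.
  exists x0, y1; split => //; rewrite -/A0 -/B1 phi_le// -/s; exact: ltW.
Qed.

Lemma phi_descent (R : realType) (n : nat) (th K : R)
  (A B : {set 'rV['F_2]_n}) :
  0 < th -> 0 < K -> (16 * th) ^+ 2 <= (2 * K)^-1 ->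
  forall (d : nat) (H : {vspace 'rV['F_2]_n}) (x y : 'rV['F_2]_n),
  let A' := A :&: translate x (vspace_set H) in
  let B' := B :&: translate y (vspace_set H) in
  (\dim H < d)%N -> A' != set0 -> B' != set0 ->
  #|sumset A' B'|%:R <= K * (Num.sqrt #|A'|%:R * Num.sqrt #|B'|%:R) ->
  exists (G : {vspace 'rV['F_2]_n}) (x' y' : 'rV['F_2]_n),
  let A'' := A :&: translate x' (vspace_set G) in
  let B'' := B :&: translate y' (vspace_set G) in
  [/\ A'' != set0, B'' != set0, phi th A'' B'' <= phi th A' B' &
      (2 * K)^-1 * #|vspace_set G|%:R <=
        Num.sqrt #|A''|%:R * Num.sqrt #|B''|%:R].
Proof.
move=> th0 K0 thK; elim=> [//|d IHd] H x y A' B' dH A'n0 B'n0 dbl.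
have [le|lt] := leP ((2 * K)^-1 * #|vspace_set H|%:R)
  (Num.sqrt #|A'|%:R * Num.sqrt #|B'|%:R); first by exists H, x, y.
have [xi [h0 [h0H c big]]] := exists_large_coeff K0 A'n0 B'n0 dbl lt.
have [x1 [y1 [A1n0 B1n0 sA sB le1]]] :=
  phi_descent_step th0 thK A'n0 B'n0 h0H c big.
rewrite -/A' -/B' in sA sB le1.
have [||//||G [x2 [y2 [A2n0 B2n0 le2 ineq]]]] := IHd (hyperplane H xi) x1 y1.
- by rewrite (leq_trans (dim_hyperplane h0H c)).
- by [].
(* The same [K] serves for the smaller pair, so the induction on dimension continues. *)
- rewrite (doubling_phi th)//; rewrite (doubling_phi th)// in dbl.
  apply: le_trans dbl; apply: ler_pM; rewrite ?phi_ge0 ?powR_ge0//.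
  rewrite ge0_ler_powR ?nnegrE ?mulr_ge0// ?(ltW th0)//.
  by rewrite ler_pM// ler_nat subset_leq_card.
- by exists G, x2, y2; split => //; apply: le_trans le2 le1.
Qed.

(** * Choice of [th] and the density bound *)

Theorem theorem1p4 (R : realType) :
  exists c C : R, 0 < c /\ 0 < C /\
  forall (n : nat) (K : R) (A B : {set 'rV['F_2]_n}),
    1 <= K -> A != set0 -> B != set0 ->
    #|sumset A B|%:R <= K * Num.sqrt (#|A|%:R) * Num.sqrt (#|B|%:R) ->
    exists (H : {vspace 'rV['F_2]_n}) (x y : 'rV['F_2]_n),
      c * K `^ (- (C * Num.sqrt K)) * #|A|%:R <= #|vspace_set H|%:R /\
      (2 * K)^-1 * #|vspace_set H|%:R <=
        Num.sqrt (#|A :&: translate x (vspace_set H)|%:R) *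
        Num.sqrt (#|B :&: translate y (vspace_set H)|%:R).
Proof.
(* The exponent is [16 k + 1 <= 17 k]: [16 k = 1 / (2 th)] from the descent, and 1 from comparing
   [|A|] with [sqrt (|A||B|)]. *)
exists 1, 17; do 2![split; first by lra].
move=> n K A B K1 An0 Bn0; rewrite -mulrA => dbl.
have K0 : 0 < K by lra.
set k := Num.sqrt K.
have kp : 0 < k by rewrite sqrtr_gt0.
have k1 : 1 <= k by rewrite -sqrtr1 ler_sqrt// ltW.
have kK : k ^+ 2 = K by rewrite sqr_sqrtr// ltW.
(* This gives [(16 th)^2 = 1 / (4K)], within the bias [1 / (2K)] that the large coefficient
   supplies. *)
pose th := (32 * k)^-1.
have th0 : 0 < th by rewrite invr_gt0 mulr_gt0.
have thK : (16 * th) ^+ 2 <= (2 * K)^-1.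
  have -> : (16 * th) ^+ 2 = (4 * K)^-1.
    by rewrite /th -kK; field; rewrite gt_eqF.
  by rewrite lef_pV2 ?posrE ?mulr_gt0// ler_pM2r// ler_nat.
have full (X : {set 'rV['F_2]_n}) : X :&: translate 0 (vspace_set fullv) = X.
  by apply/setP => v; rewrite !inE mem_translate inE memvf andbT.
have := phi_descent (A := A) (B := B) th0 K0 thK (x := 0) (y := 0) (ltnSn (\dim {:'rV['F_2]_n})).
rewrite !full => /(_ An0 Bn0 dbl)[H [x [y [A'n0 B'n0 le ineq]]]].
exists H, x, y; split => //; move: le {ineq}.
set A' := A :&: _ in A'n0 *; set B' := B :&: _ in B'n0 *; move=> le.
set h : R := #|vspace_set H|%:R.
set M : R := #|A|%:R * #|B|%:R; set M' : R := #|A'|%:R * #|B'|%:R.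
have [M0 M'0] : 0 <= M /\ 0 <= M' by split; rewrite mulr_ge0.
(* Chain [1 <= phi th A' B' * M']^ th[,]phi th A' B' <= phi th A B[and]phi th A B * M
   [^ th <= K]. *)
have lead : M `^ th <= K * M' `^ th.
  have l1 : 1 <= phi th A' B' * M' `^ th.
    have := sqrt_card_le_sumset R A'n0 B'n0; rewrite -(phi_mul th A'n0 B'n0).
    rewrite -[leLHS]mul1r ler_pM2r// mulr_gt0// sqrtr_gt0 ltr0n card_gt0//.
  have l2 : phi th A B * M `^ th <= K by rewrite -doubling_phi.
  have l3 := ler_wpM2r (powR_ge0 M th) l1.
  rewrite mul1r in l3; apply: (le_trans l3).
  have l4 := ler_wpM2r (powR_ge0 M' th) l2; apply: le_trans l4.
  rewrite mulrAC ler_wpM2r ?powR_ge0// ler_wpM2r ?powR_ge0//.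
have root : Num.sqrt M <= K `^ (16 * k) * Num.sqrt M'.
  have e : th * (16 * k) = 2^-1 by rewrite /th; field; rewrite gt_eqF.
  have k16 : 0 <= 16 * k by rewrite mulr_ge0// ltW.
  have := ge0_ler_powR k16 _ _ lead; rewrite !nnegrE powR_ge0 mulr_ge0 ?powR_ge0 ?(ltW K0)//.
  move=> /(_ isT isT); rewrite powRM ?powR_ge0 ?(ltW K0)// -!powRrM e.
  by rewrite !powR12_sqrt.
have small : Num.sqrt M' <= h.
  have le_h (X : {set 'rV['F_2]_n}) z : #|X :&: translate z (vspace_set H)|%:R <= h.
    rewrite ler_nat (leq_trans (subset_leq_card (subsetIr _ _)))//.
    exact: leq_imset_card.
  rewrite -(@ger0_norm _ h)// -sqrtr_sqr ler_sqrt ?sqr_ge0// expr2.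
  by apply: ler_pM => //; apply: le_h.
(* [|A| <= |A+B|] and the doubling hypothesis turn control of the geometric mean into control of
   [|A|] alone. *)
have Ale : #|A|%:R <= K * Num.sqrt M.
  by rewrite /M sqrtrM//; apply: le_trans dbl; rewrite ler_nat leq_card_sumset.
have Kpow : K * K `^ (16 * k) <= K `^ (17 * k).
  have {1}-> : K = K `^ 1 by rewrite powRr1// ltW.
  by rewrite -powRD ?(gt_eqF K0) ?implybT// ler_powR//; lra.
rewrite mul1r powRN mulrC ler_pdivrMr ?powR_gt0// [leRHS]mulrC.
apply: le_trans Ale _; apply: le_trans (ler_wpM2l (ltW K0) root) _.
rewrite mulrA; apply: ler_pM => //; rewrite ?mulr_ge0 ?powR_ge0 ?sqrtr_ge0//.
exact: ltW.
Qed.
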